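(* Let $q$ be a power of $2$. Then $DI(q)$ is a vector space over $\mathbb{Z}/2$ of dimension $q$.
   Context: Let $p_{3,2}:\mathbb{Z}/2[[x]]\to\mathbb{Z}/2[[x]]$ send $\sum c_nx^n$ to $\sum_{n\equiv2\ (3)}c_nx^n$. Every ideal of $\mathbb{Z}[i]$ of odd norm has a generator $a+2bi$ with $a$ odd, unique up to sign. Two such ideals $(\alpha),(\beta)$ (generators of this form) are Gauss-equivalent if there is an integer $N$ with $N\alpha\equiv\beta\pmod{4q\mathbb{Z}[i]}$; the equivalence classes are Gauss-classes. $\mathit{AMB}$ is the Gauss-class consisting of the ideals $(a+2bqi)$ with $a,b$ odd. For a Gauss-class $R$, $\theta(R)=\sum_{I\in R}x^{\mathrm{norm}(I)}\in\mathbb{Z}[[x]]$; $\theta(\mathit{AMB})\in2\mathbb{Z}[[x]]$. $DI(q)$ is the image under $p_{3,2}$ of the $\mathbb{Z}/2$-span of the mod $2$ reductions of all $\theta(R)$ ($R$ a Gauss-class) and of $\tfrac12\theta(\mathit{AMB})$. *)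

(* Defs.v *)
From HB Require Import structures.
From mathcomp Require Import all_boot all_order all_algebra.
From mathcomp Require Import finmap.
From mathcomp Require Import all_classical.
From mathcomp Require Import ring.
Set Implicit Arguments.
Unset Strict Implicit.
Unset Printing Implicit Defensive.
Import Order.TTheory GRing.Theory Num.Theory.
Local Open Scope classical_set_scope.
Local Open Scope ring_scope.

(* Z[i]: [GInt a b] is a + b i. *)
Record gint := GInt { gre : int; gim : int }.

Definition gint_pair (z : gint) : int * int := (gre z, gim z).
Definition pair_gint (p : int * int) : gint := GInt p.1 p.2.

Lemma gint_pairK : cancel gint_pair pair_gint.
Proof. by case. Qed.

HB.instance Definition _ := Countable.copy gint (can_type gint_pairK).

Definition gint_add (z w : gint) := GInt (gre z + gre w) (gim z + gim w).
Definition gint_opp (z : gint) := GInt (- gre z) (- gim z).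
Definition gint_mul (z w : gint) :=
  GInt (gre z * gre w - gim z * gim w) (gre z * gim w + gim z * gre w).

Lemma gint_addA : associative gint_add.
Proof. by move=> [a b] [c d] [e f]; congr GInt => /=; ring. Qed.

Lemma gint_addC : commutative gint_add.
Proof. by move=> [a b] [c d]; congr GInt => /=; ring. Qed.

Lemma gint_add0 : left_id (GInt 0 0) gint_add.
Proof. by move=> [a b]; congr GInt => /=; ring. Qed.

Lemma gint_addN : left_inverse (GInt 0 0) gint_opp gint_add.
Proof. by move=> [a b]; congr GInt => /=; ring. Qed.

HB.instance Definition _ :=
  GRing.isZmodule.Build gint gint_addA gint_addC gint_add0 gint_addN.

Lemma gint_mulA : associative gint_mul.
Proof. by move=> [a b] [c d] [e f]; congr GInt => /=; ring. Qed.

Lemma gint_mulC : commutative gint_mul.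
Proof. by move=> [a b] [c d]; congr GInt => /=; ring. Qed.

Lemma gint_mul1 : left_id (GInt 1 0) gint_mul.
Proof. by move=> [a b]; congr GInt => /=; ring. Qed.

Lemma gint_mulD : left_distributive gint_mul gint_add.
Proof. by move=> [a b] [c d] [e f]; congr GInt => /=; ring. Qed.

Lemma gint_1neq0 : GInt 1 0 != 0.
Proof. by []. Qed.

HB.instance Definition _ := GRing.Zmodule_isComNzRing.Build gint
  gint_mulA gint_mulC gint_mul1 gint_mulD gint_1neq0.

(* The library's [idealr_closed] only covers proper ideals; the unit ideal has
   odd norm 1 and is needed here. *)
Definition is_ideal (I : set gint) : Prop :=
  [/\ I 0, forall u v, I u -> I v -> I (u + v) & forall a u, I u -> I (a * u)].

Definition principal (alpha : gint) : set gint := [set alpha * z | z in setT].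

(* #|Z[i] / I|; [fset_set] sends infinite sets to the empty set, so this is 0
   for the zero ideal. *)
Definition ideal_norm (I : set gint) : nat :=
  #|` fset_set (range (fun z : gint => [set z + u | u in I])) |.

Definition odd_ideal (I : set gint) : Prop := is_ideal I /\ odd (ideal_norm I).

Definition normalized (alpha : gint) : Prop :=
  exists a b : int, odd `|a|%N /\ alpha = GInt a (2 * b).

Definition gauss_equiv (q : nat) (I J : set gint) : Prop :=
  exists alpha beta : gint,
    [/\ normalized alpha, normalized beta,
        I = principal alpha, J = principal beta
      & exists (N : int) (gamma : gint),
          N%:~R * alpha - beta = (4 * q)%:R * gamma].

Definition gauss_class (q : nat) (R : set (set gint)) : Prop :=
  exists I, odd_ideal I /\ R = [set J | odd_ideal J /\ gauss_equiv q I J].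

Definition AMB (q : nat) : set (set gint) :=
  [set I | exists a b : int,
     [/\ odd `|a|%N, odd `|b|%N & I = principal (GInt a (2 * b * q%:Z))]].

(* A power series is its sequence of coefficients; only the linear structure
   on Z/2[[x]] is used. *)
Notation series2 := (nat -> ('F_2)^o).

Definition theta (R : set (set gint)) : nat -> int :=
  fun n => (#|` fset_set (R `&` [set I | ideal_norm I = n]) |)%:Z.

(* The division is exact for [theta (AMB q)], whose coefficients are even. *)
Definition half (f : nat -> int) : nat -> int := fun n => (f n %/ 2)%Z.

Definition mod2 (f : nat -> int) : series2 := fun n => (f n)%:~R.

Definition p32 (f : series2) : series2 :=
  fun n => if (n %% 3 == 2)%N then f n else 0.

Definition lspan (K : fieldType) (V : lmodType K) (G : set V) : set V :=
  [set v | exists (n : nat) (g : 'I_n -> V) (c : 'I_n -> K),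
     (forall i, G (g i)) /\ v = \sum_(i < n) c i *: g i].

Definition lin_independent (K : fieldType) (V : lmodType K) (d : nat)
    (b : 'I_d -> V) : Prop :=
  forall c : 'I_d -> K, \sum_(i < d) c i *: b i = 0 -> forall i, c i = 0.

Definition subspace_of_dim (K : fieldType) (V : lmodType K) (W : set V)
    (d : nat) : Prop :=
  GRing.submod_closed (mem W) /\
  exists b : 'I_d -> V, lin_independent b /\ lspan (range b) = W.

Definition DI (q : nat) : set series2 :=
  p32 @` lspan ([set mod2 (theta R) | R in gauss_class q]
                `|` [set mod2 (half (theta (AMB q)))]).

(* Main.v *)
Require Import Defs.
From mathcomp Require Import all_boot all_order all_algebra all_classical.
From mathcomp Require Import finmap ring zify.
Set Implicit Arguments.
Unset Strict Implicit.
Unset Printing Implicit Defensive.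
Import Order.TTheory GRing.Theory Num.Theory.

(** The class of the ideal (a + 2bi) is the residue of b/a modulo 2q, so there
    are 2q classes and conjugation is c |-> -c. A series supported on
    exponents n = 2 mod 3 sees only ideals (x + 2yi) with y <> 0; pairing
    conjugates kills theta of the classes 0 and q modulo 2, and DI(q) is
    spanned by the q series attached to the classes +-c, 1 <= c <= q (c = q
    being half of AMB).

    A linear relation between these series is an even function f on classes,
    with f(0) = 0, whose sum over the pairs x odd, y > 0, x^2 + 4y^2 = n
    vanishes whenever n = 2 mod 3. Let pi = 1 + 2i, rho = 3 + 2i. For odd k,
    discarding representations divisible by 5, n = 5^k gives f(pi^k) = 0 and
    n = 13 * 5^k gives f(rho pi^k) = f(rho conj(pi)^k). The group of classes is
    cyclic of 2-power order, generated by pi and also by rho; hence f vanishes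
    on odd classes, and f(rho z) = f(rho conj(z)) for z = rho^(2l-1) gives
    f(rho^(2l)) = f(rho^(2l-2)) = ... = f(1) = 0 on the even ones. *)

(** * Norms and generators of odd ideals *)

Section Ideals.
Local Open Scope classical_set_scope.
Local Open Scope ring_scope.

Lemma card_fset_set_seq (T : choiceType) (A : set T) (s : seq T) :
  uniq s -> (forall x, A x <-> x \in s) -> #|` fset_set A| = size s.
Proof.
move=> us As.
have -> : A = [set` [fset x in s]%fset].
  by apply/seteqP; split=> x /=; rewrite !inE; apply As.
by rewrite set_fsetK card_fseq undup_id.
Qed.

Lemma gint_intr (N : int) : N%:~R = GInt N 0 :> gint.
Proof.
have natE (n : nat) : n%:R = GInt n%:Z 0 :> gint.
  by elim: n => [|n IH] //; rewrite -natr1 IH; congr GInt => /=; lia.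
case: N => n; first exact: natE.
by rewrite NegzE mulrNz -pmulrn natE; congr GInt.
Qed.

Lemma gint_natr (n : nat) : n%:R = GInt n%:Z 0 :> gint.
Proof. by rewrite -gint_intr. Qed.

Lemma mem_principal (a b s t : int) :
  principal (GInt a b) (GInt s t) <->
  exists x y : int, s = a * x - b * y /\ t = a * y + b * x.
Proof.
split; first by move=> [[x y] _ [<- <-]]; exists x, y.
by move=> [x [y [-> ->]]]; exists (GInt x y).
Qed.

Lemma principal_ideal alpha : is_ideal (principal alpha).
Proof.
split.
- by exists 0 => //; rewrite mulr0.
- by move=> _ _ [u _ <-] [v _ <-]; exists (u + v) => //; rewrite mulrDr.
- by move=> c _ [u _ <-]; exists (c * u) => //; rewrite mulrCA.
Qed.

Lemma coset_eq (I : set gint) z w : is_ideal I ->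
  [set z + u | u in I] = [set w + u | u in I] <-> I (z - w).
Proof.
move=> [I0 ID IM]; split.
  move=> E; have : [set w + u | u in I] z by rewrite -E; exists 0; rewrite ?addr0.
  by case=> u Iu <-; rewrite addrC addKr.
move=> Izw; apply/seteqP; split=> _ [u Iu <-].
  by exists ((z - w) + u); [exact: ID | rewrite addrA addrC subrKC addrC].
exists ((-1) * (z - w) + u); first exact/ID/Iu/IM.
by rewrite mulN1r opprB addrA subrKC.
Qed.

Lemma congr_small_eq (D x y : nat) (k : int) : (x < D)%N -> (y < D)%N ->
  x%:Z - y%:Z = k * D -> x = y.
Proof.
move=> xD yD E; have [k0|[k1|k1]] : k = 0 \/ 1 <= k \/ k <= -1 by lia.
- by move: E; rewrite k0; lia.
- have : 0 <= (k - 1) * D by apply: mulr_ge0; lia.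
  by rewrite mulrBl; lia.
- have : 0 <= (- 1 - k) * D by apply: mulr_ge0; lia.
  by rewrite mulrBl; lia.
Qed.

(* With [d = gcd a b], the box [0, (a^2+b^2)/d) x [0, d) is a transversal of
   the lattice spanned by [a + bi] and [i(a + bi)]. *)
Lemma ideal_norm_principal (a b : int) : a != 0 ->
  ideal_norm (principal (GInt a b)) = `|(a ^+ 2 + b ^+ 2)%R|%N.
Proof.
move=> a0.
have [d d0 [a' [b' [Ea Eb [u [v uv]]]]]] : exists2 d : nat, (0 < d)%N &
    exists a' b' : int, [/\ a = a' * d, b = b' * d &
      exists u v : int, u * a' + v * b' = 1].
  have g0 : gcdz a b != 0 by rewrite gcdz_eq0 (negPf a0).
  have gE : gcdz a b = `|gcdz a b|%N :> int by [].
  exists `|gcdz a b|%N; first by rewrite absz_gt0.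
  have /dvdzP[a' Ea] := dvdz_gcdl a b; have /dvdzP[b' Eb] := dvdz_gcdr a b.
  exists a', b'; rewrite -gE; split=> //.
  have [u [v uv]] := Bezoutz a b; exists u, v.
  apply: (mulIf g0); rewrite mul1r -[RHS]uv mulrDl -!mulrA -Ea -Eb //.
pose M := `|(a' ^+ 2 + b' ^+ 2)%R|%N.
have ME : M%:Z = a' ^+ 2 + b' ^+ 2 by rewrite /M; nia.
have M0 : (0 < M)%N.
  have : a' != 0 by apply: contraNneq a0 => a'0; rewrite Ea a'0 mul0r.
  by move=> a0'; have : 0 < M%:Z by [rewrite ME; nia]; lia.
pose box := [seq (x, y) | x <- iota 0 (d * M), y <- iota 0 d].
pose co (t : nat * nat) := [set GInt t.1%:Z t.2%:Z + w | w in principal (GInt a b)].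
have -> : `|(a ^+ 2 + b ^+ 2)%R|%N = size (map co box).
  by rewrite size_map size_allpairs !size_iota Ea Eb !exprMn -mulrDl -ME; nia.
have Pid := principal_ideal (GInt a b).
apply: card_fset_set_seq.
  rewrite map_inj_in_uniq; last first.
    move=> [x y] [x' y'] /allpairsP[[x1 y1] /= [+ + [e1 e2]]].
    rewrite -e1 -e2 !mem_iota /= !add0n => xl yl.
    move=> /allpairsP[[x2 y2] /= [+ + [e3 e4]]].
    rewrite -e3 -e4 !mem_iota /= !add0n => xl' yl'.
    move=> /(coset_eq _ _ Pid) /mem_principal [p [r []]] /=.
    rewrite Ea Eb => ex ey.
    have ey1 : y%:Z - y'%:Z = (a' * r + b' * p) * d by rewrite ey; ring.
    have eyy := congr_small_eq yl yl' ey1.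
    have k0 : a' * r + b' * p = 0.
      by move: ey1; rewrite eyy subrr => /esym/eqP; rewrite mulf_eq0 => /orP[/eqP //|]; lia.
    (* (p, r) is proportional to (a', -b') *)
    have ep : p = a' * (u * p - v * r).
      rewrite -[LHS]mul1r -uv; transitivity (a' * (u * p - v * r) + v * (a' * r + b' * p)).
        by ring.
      by rewrite k0 mulr0 addr0.
    have er : r = - b' * (u * p - v * r).
      rewrite -[LHS]mul1r -uv; transitivity (- b' * (u * p - v * r) + u * (a' * r + b' * p)).
        by ring.
      by rewrite k0 mulr0 addr0.
    move: ep er; set k := u * p - v * r => ep er.
    rewrite eyy (@congr_small_eq (d * M) x x' k) //.
    by rewrite ex PoszM ME ep er; ring.
  by apply: allpairs_uniq => //; [exact: iota_uniq|exact: iota_uniq|move=> [? ?] [? ?]].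
move=> J; split; last first.
  by move=> /mapP[t _ ->]; exists (GInt t.1%:Z t.2%:Z).
move=> [[s t] _ <-].
pose tau := (t %/ d%:Z)%Z; pose t0 := (t %% d%:Z)%Z.
have tE : t = tau * d + t0 := divz_eq t d.
(* The multiple of a + bi by v tau + u tau i has imaginary part tau d, by the Bezout relation;
   subtracting it brings t into [0, d). Then s is reduced modulo dM by multiples of (a + bi)(a' -
   b'i) = dM, which is real. *)
pose s1 := s - (a * (v * tau) - b * (u * tau)).
pose sig := (s1 %/ (d * M)%N%:Z)%Z; pose s0 := (s1 %% (d * M)%N%:Z)%Z.
have sE : s1 = sig * (d * M)%N + s0 := divz_eq s1 (d * M)%N.
have dn0 : d%:Z != 0 by lia.
have dMn0 : (d * M)%N%:Z != 0 by rewrite eqz_nat muln_eq0; lia.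
have t0p : 0 <= t0 := modz_ge0 _ dn0.
have s0p : 0 <= s0 := modz_ge0 _ dMn0.
have t0l : t0 < d by rewrite -[X in _ < Posz X](absz_nat d); exact: ltz_mod.
have s0l : s0 < (d * M)%N by rewrite -[X in _ < Posz X](absz_nat (d * M)); exact: ltz_mod.
apply/mapP; exists (`|s0|%N, `|t0|%N).
  by apply/allpairsP; exists (`|s0|%N, `|t0|%N) => /=; rewrite !mem_iota /=; split => //; lia.
apply/(coset_eq _ _ Pid); rewrite /co /= !gez0_abs //.
apply/mem_principal; exists (v * tau + a' * sig), (u * tau - b' * sig); split => /=.
  have -> : s = s1 + (a * (v * tau) - b * (u * tau)) by rewrite /s1; ring.
  by rewrite sE PoszM ME Ea Eb; ring.
rewrite tE Ea Eb -{1}[tau]mul1r -uv; ring.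
Qed.

Lemma ideal_norm_normalized (x y : int) : odd `|x|%N ->
  ideal_norm (principal (GInt x (2 * y))) = `|(x ^+ 2 + 4 * y ^+ 2)%R|%N.
Proof.
move=> ox; rewrite ideal_norm_principal; last by apply: contraTneq ox => ->.
by congr absz; ring.
Qed.

Lemma sum_sqr_eq1 (m n : nat) :
  (m ^ 2 + n ^ 2 = 1 -> (m = 0 /\ n = 1) \/ (m = 1 /\ n = 0))%N.
Proof.
by case: m => [|[|m]]; case: n => [|[|n]] //=; rewrite ?expnS ?expn0; auto; lia.
Qed.

Lemma sqr_absz_nat (z : int) : z ^+ 2 = (`|z| ^ 2)%N.
Proof. by rewrite -abszX gez0_abs ?sqr_ge0. Qed.

(** Each generator divides the other, so their quotient p + ri has norm 1. The units i and -i are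
    excluded because they would make the real part a even. *)
Lemma principal_inj (a b x y : int) : odd `|a|%N -> odd `|x|%N ->
  principal (GInt a (2 * b)) = principal (GInt x (2 * y)) ->
  (x = a /\ y = b) \/ (x = - a /\ y = - b).
Proof.
move=> oa ox E.
have Ia : principal (GInt x (2 * y)) (GInt a (2 * b)).
  by rewrite -E; exists 1 => //; rewrite mulr1.
have Ix : principal (GInt a (2 * b)) (GInt x (2 * y)).
  by rewrite E; exists 1 => //; rewrite mulr1.
have /mem_principal[p [r [ea eb]]] := Ia.
have /mem_principal[p' [r' [ex ey]]] := Ix.
have N1 : a ^+ 2 + (2 * b) ^+ 2 = (x ^+ 2 + (2 * y) ^+ 2) * (p ^+ 2 + r ^+ 2).
  by rewrite ea eb; ring.
have N2 : x ^+ 2 + (2 * y) ^+ 2 = (a ^+ 2 + (2 * b) ^+ 2) * (p' ^+ 2 + r' ^+ 2).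
  by rewrite {1}ex {1}ey; ring.
have x0 : x != 0 by apply: contraTneq ox => ->.
have Nx : x ^+ 2 + (2 * y) ^+ 2 != 0.
  by rewrite paddr_eq0 ?sqr_ge0 // sqrf_eq0 (negPf x0).
have N3 : (p ^+ 2 + r ^+ 2) * (p' ^+ 2 + r' ^+ 2) = 1.
  apply: (@mulfI _ (x ^+ 2 + (2 * y) ^+ 2)); first exact: Nx.
  by rewrite mulrA -N1 -N2 mulr1.
have N4 : (`|p| ^ 2 + `|r| ^ 2 = 1)%N.
  have /(congr1 absz) := N3; rewrite abszM => /eqP; rewrite muln_eq1 => /andP[/eqP + _].
  by rewrite !sqr_absz_nat.
have [[/eqP + _]|[p1 /eqP]] := sum_sqr_eq1 N4; rewrite absz_eq0 => /eqP r0.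
  by move: oa; rewrite ea r0 mulr0 sub0r abszN !abszM !oddM.
have {N1 N2 N3 N4 Nx ex ey Ia Ix E} : p = 1 \/ p = -1 by clear -p1; lia.
by move: ea eb; rewrite r0 => ea eb [pE|pE]; move: ea eb; rewrite pE; [left|right]; lia.
Qed.

(** A pair (x, y) with y > 0 stands for the two conjugate ideals (x + 2yi) and (x - 2yi). *)
Definition reps (n : nat) : seq (nat * nat) :=
  [seq t <- [seq (x, y) | x <- iota 0 n.+1, y <- iota 0 n.+1]
     | [&& odd t.1, 0 < t.2 & t.1 ^ 2 + 4 * t.2 ^ 2 == n]%N].

Lemma mem_reps n (t : nat * nat) :
  (t \in reps n) = [&& odd t.1, 0 < t.2 & t.1 ^ 2 + 4 * t.2 ^ 2 == n]%N.
Proof.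
case: t => x y; rewrite mem_filter [fst _]/= [snd _]/=.
case: and3P => // -[ox y0 /eqP E]; rewrite andTb.
have sq m : (m <= m ^ 2)%N by case: m => // m; rewrite leq_pmulr.
have xn : (x < n.+1)%N by have := sq x; lia.
have yn : (y < n.+1)%N by have := sq y; lia.
by apply/allpairsP; exists (x, y); rewrite !mem_iota.
Qed.

Lemma reps_uniq n : uniq (reps n).
Proof.
by apply/filter_uniq/allpairs_uniq; rewrite ?iota_uniq // => -[? ?] [? ?].
Qed.

(** Squares are 0 or 1 modulo 3, so y = 0 cannot occur and each pair of [reps n] gives two distinct
    ideals. The predicate [Q] on generators covers both Gauss-classes and [AMB]. *)
Lemma theta_reps (R : set (set gint)) (n : nat) (Q : int -> int -> bool) :
  (n %% 3 = 2)%N ->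
  (forall x y, Q (- x) (- y) = Q x y) ->
  (forall J, R J -> ideal_norm J = n -> exists x y : int,
     [/\ odd `|x|%N, Q x y & J = principal (GInt x (2 * y))]) ->
  (forall x y : int, odd `|x|%N -> Q x y -> R (principal (GInt x (2 * y)))) ->
  theta R n = (\sum_(t <- reps n) (Q t.1%:Z t.2%:Z + Q t.1%:Z (- t.2%:Z)))%N.
Proof.
move=> n3 QN RQ QR.
pose J1 (t : nat * nat) := principal (GInt t.1%:Z (2 * t.2%:Z)).
pose J2 (t : nat * nat) := principal (GInt t.1%:Z (2 * - t.2%:Z)).
pose s1 := [seq t <- reps n | Q t.1%:Z t.2%:Z].
pose s2 := [seq t <- reps n | Q t.1%:Z (- t.2%:Z)].
rewrite /theta; congr Posz.
have -> : (\sum_(t <- reps n) (Q t.1%:Z t.2%:Z + Q t.1%:Z (- t.2%:Z)))%N =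
    size (map J1 s1 ++ map J2 s2).
  rewrite size_cat !size_map !size_filter -!sum1_count big_split /=.
  by congr addn; rewrite [RHS]big_mkcond; apply: eq_bigr => t _; case: (Q _ _).
have reps_eq (t t' : nat * nat) (e e' : int) : t \in reps n -> t' \in reps n ->
    principal (GInt t.1%:Z (2 * (e * t.2%:Z))) =
    principal (GInt t'.1%:Z (2 * (e' * t'.2%:Z))) ->
    t.1 = t'.1 /\ e * t.2%:Z = e' * t'.2%:Z.
  rewrite !mem_reps => /and3P[o _ _] /and3P[o' _ _].
  by move=> /principal_inj[] //; lia.
apply: card_fset_set_seq.
  rewrite cat_uniq; apply/and3P; split.
  - rewrite map_inj_in_uniq; first exact/filter_uniq/reps_uniq.
    move=> -[x y] [x' y'].
    rewrite mem_filter => /andP[_ h]; rewrite mem_filter => /andP[_ h'] E.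
    have [] := reps_eq _ _ 1 1 h h'; first by rewrite /= !mul1r.
    by move=> /= -> e; congr pair; lia.
  - apply/hasPn => _ /mapP[t' ht' ->]; apply/negP => /mapP[t ht E].
    move: ht ht'; rewrite mem_filter => /andP[_ h]; rewrite mem_filter => /andP[_ h'].
    have [] := reps_eq _ _ (-1) 1 h' h; first by rewrite /= !mul1r mulN1r.
    by move: h h'; rewrite !mem_reps => /and3P[_ + _] /and3P[_ + _]; clear; lia.
  - rewrite map_inj_in_uniq; first exact/filter_uniq/reps_uniq.
    move=> -[x y] [x' y'].
    rewrite mem_filter => /andP[_ h]; rewrite mem_filter => /andP[_ h'] E.
    have [] := reps_eq _ _ (-1) (-1) h h'; first by rewrite /= !mulN1r.
    by move=> /= -> e; congr pair; lia.
have wlog_pos (x y : int) : odd `|x|%N -> Q x y -> exists x' : nat, exists y' : int,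
    [/\ odd x', Q x' y', x'%:Z ^+ 2 = x ^+ 2, y' ^+ 2 = y ^+ 2 &
      principal (GInt x (2 * y)) = principal (GInt x' (2 * y'))].
  move=> ox Qxy; case: (leP 0 x) => x0.
    by exists `|x|%N, y; rewrite gez0_abs.
  exists `|x|%N, (- y); rewrite ltz0_abs // QN !sqrrN; split=> //.
  have -> : GInt (- x) (2 * - y) = GInt x (2 * y) * -1.
    by rewrite mulrN1 mulrN.
  apply/seteqP; split=> _ [z _ <-].
    by exists (- z) => //; rewrite -mulrA mulN1r opprK.
  by exists (- z) => //; rewrite mulrN -mulrA mulN1r mulrN.
move=> J; split.
  move=> [RJ nJ]; have [x [y [ox Qxy EJ]]] := RQ J RJ nJ.
  have [x' [y' [ox' Qxy' ex ey EJ']]] := wlog_pos x y ox Qxy.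
  move: nJ; rewrite EJ EJ' /= ideal_norm_normalized // => nE.
  have nE1 : (x' ^ 2 + 4 * `|y'| ^ 2)%N = n by lia.
  have y0 : y' != 0.
    apply: contra_eq_neq n3 => y0; move: nE1; rewrite y0 /= => <-.
    by rewrite exp0n // addn0 -modnXm; case: (x' %% 3)%N (ltn_pmod x' (isT : 0 < 3)%N) => [|[|[|]]].
  have xr : (x', `|y'|%N) \in reps n by rewrite mem_reps ox' nE1 eqxx absz_gt0 y0.
  rewrite mem_cat; apply/orP; case: (leP 0 y') => yp; [left|right].
    apply/mapP; exists (x', `|y'|%N); last by rewrite /J1 [snd _]/= gez0_abs.
    by rewrite mem_filter xr andbT [snd _]/= gez0_abs.
  apply/mapP; exists (x', `|y'|%N); last by rewrite /J2 [snd _]/= ltz0_abs // opprK.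
  by rewrite mem_filter xr andbT [snd _]/= ltz0_abs // opprK.
rewrite mem_cat => /orP[] /mapP[t].
  rewrite mem_filter mem_reps => /andP[Qt /and3P[o t0 /eqP nE]] ->; split; first exact: QR.
  by rewrite /J1 /= ideal_norm_normalized //; lia.
rewrite mem_filter mem_reps => /andP[Qt /and3P[o t0 /eqP nE]] ->; split; first exact: QR.
by rewrite /J2 /= ideal_norm_normalized //; lia.
Qed.

End Ideals.

(** * Arithmetic of classes *)

Section GaussIntegers.
Local Open Scope ring_scope.

Definition gconj (z : gint) := GInt (gre z) (- gim z).
Definition normg (z : gint) : int := gre z ^+ 2 + gim z ^+ 2.
(** The imaginary part of z conj(w). For generators a + 2bi and c + 2di it is 2(bc - ad), so
    divisibility by 2^(m+2) means b/a = d/c modulo 2^(m+1). *)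
Definition crossg (z w : gint) : int := gim z * gre w - gim w * gre z.

Lemma gint_ext (z w : gint) : gre z = gre w -> gim z = gim w -> z = w.
Proof. by case: z w => [a b] [c d] /= -> ->. Qed.

Lemma greM z w : gre (z * w) = gre z * gre w - gim z * gim w. Proof. by []. Qed.
Lemma gimM z w : gim (z * w) = gre z * gim w + gim z * gre w. Proof. by []. Qed.

Lemma normgM z w : normg (z * w) = normg z * normg w.
Proof. by rewrite /normg greM gimM; ring. Qed.

Lemma gconjM z w : gconj (z * w) = gconj z * gconj w.
Proof. by apply: gint_ext; rewrite /= ?greM ?gimM /=; ring. Qed.

Lemma gconjX z k : gconj (z ^+ k) = gconj z ^+ k.
Proof. by elim: k => // k IH; rewrite !exprS gconjM IH. Qed.

Lemma gconjK : involutive gconj.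
Proof. by move=> [a b]; rewrite /gconj /= opprK. Qed.

Lemma crossgM z w u : crossg (u * z) (u * w) = normg u * crossg z w.
Proof. by rewrite /crossg /normg !greM !gimM; ring. Qed.

Lemma oddzP (a : int) : odd `|a|%N <-> exists k, a = 2 * k + 1.
Proof.
split=> [oa|[k ->]]; last by lia.
by exists ((a - 1) %/ 2)%Z; lia.
Qed.

Lemma normalizedP z :
  normalized z <-> exists a b : int, z = GInt (2 * a + 1) (2 * b).
Proof.
split=> [[a [b [/oddzP[k ->] ->]]]|[a [b ->]]]; first by exists k, b.
by exists (2 * a + 1), b; split=> //; apply/oddzP; exists a.
Qed.

Lemma normalized1 : normalized 1.
Proof. by exists 1, 0. Qed.

Lemma normalizedN z : normalized z -> normalized (- z).
Proof.
move=> /normalizedP[a [b ->]]; apply/normalizedP; exists (- a - 1), (- b).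
by apply: gint_ext => /=; ring.
Qed.

Lemma normalized_conj z : normalized z -> normalized (gconj z).
Proof.
move=> /normalizedP[a [b ->]]; apply/normalizedP; exists a, (- b).
by apply: gint_ext => /=; ring.
Qed.

Lemma normalizedM z w : normalized z -> normalized w -> normalized (z * w).
Proof.
move=> /normalizedP[a [b ->]] /normalizedP[c [d ->]]; apply/normalizedP.
exists (2 * a * c + a + c - 2 * b * d), ((2 * a + 1) * d + b * (2 * c + 1)).
by apply: gint_ext; rewrite /= ?greM ?gimM /=; ring.
Qed.

Lemma normalizedX z k : normalized z -> normalized (z ^+ k).
Proof.
move=> nz; elim: k => [|k IH]; first exact: normalized1.
by rewrite exprS; apply: normalizedM.
Qed.

Definition odd_class (z : gint) : Prop :=
  exists a b : int, z = GInt (2 * a + 1) (2 * (2 * b + 1)).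

Lemma odd_class_normalized z : odd_class z -> normalized z.
Proof. by move=> [a [b ->]]; apply/normalizedP; exists a, (2 * b + 1). Qed.

Lemma odd_class_expr z k : odd_class z -> exists a b : int,
  z ^+ k = GInt (2 * a + 1) (2 * (2 * b + (odd k : nat)%:Z)).
Proof.
move=> [a [b ->]]; elim: k => [|k [c [d IH]]]; first by exists 0, 0.
exists (a * (2 * c + 1) + c - (2 * b + 1) * 2 * (2 * d + (odd k : nat)%:Z)).
exists (a * (2 * d + odd k) + d + (2 * c + 1) * b + c + (odd k : nat)%:Z).
have /= -> : (odd k.+1 : nat)%:Z = 1 - (odd k : nat)%:Z by rewrite /=; case: (odd k).
by rewrite exprS IH; apply: gint_ext; rewrite ?greM ?gimM /=; ring.
Qed.

Lemma odd_class_exprXX z s : odd_class z -> exists a b : int,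
  z ^+ (2 ^ s) = GInt (2 * a + 1) (2 ^+ s.+1 * (2 * b + 1)).
Proof.
move=> [a [b ->]]; elim: s => [|s [c [d IH]]]; first by exists a, b; rewrite expr1.
rewrite expnS mulnC exprM IH; move: (2 ^+ s.+1) (exprS (2 : int) s) => e eE.
rewrite !exprS -eE.
exists (2 * c * c + 2 * c - 2 * (2 ^+ s) ^+ 2 * (2 * d + 1) ^+ 2).
exists (2 * c * d + c + d).
by apply: gint_ext; rewrite ?expr0 ?mulr1 ?greM ?gimM /= ?eE; ring.
Qed.

(* The classes modulo [2 ^ s] form a cyclic group, generated by any odd class:
   successive squares of an odd class have imaginary part of 2-adic valuation
   growing by exactly one, which lets one correct one binary digit at a time. *)
Lemma odd_class_generates t z s : odd_class t -> normalized z ->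
  exists k, (2 ^+ s.+1 %| crossg (t ^+ k) z)%Z.
Proof.
move=> ot nz; have [a [b zE]] := (normalizedP z).1 nz.
elim: s => [|s [k /dvdzP[u uE]]].
  by exists 0%N; apply/dvdzP; exists (- b); rewrite /crossg zE /=; ring.
have [u' [uE'|uE']] : exists u', u = 2 * u' \/ u = 2 * u' + 1.
  by exists (u %/ 2)%Z; lia.
  by exists k; apply/dvdzP; exists u'; rewrite uE uE' [2 ^+ s.+2]exprS; ring.
(* Here u is odd. With e = 2^(s+1) and T = t^(2^s), the new cross term is Re(T) u e + Im(T) Re(t^k
   conj(z)). Both summands are odd multiples of e, so 2e divides their sum. *)
exists (2 ^ s + k)%N; rewrite exprD.
have [c [d ->]] := odd_class_exprXX s ot.
have [x [w ww]] := (normalizedP _).1 (normalizedX k (odd_class_normalized ot)).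
move: uE; rewrite ww zE /crossg ?greM ?gimM [2 ^+ s.+2]exprS; move: (2 ^+ s.+1) => e /= uE.
apply/dvdzP.
exists ((2 * c + 1) * u' + c + (2 * x + 1) * (2 * a + 1) * d +
        2 * x * a + x + a + 1 + 2 * b * w * (2 * d + 1)).
transitivity ((2 * c + 1) * (u * e) + (2 * x + 1) * (2 * a + 1) * (e * (2 * d + 1))
   + 2 * b * (2 * w) * (e * (2 * d + 1))); last by rewrite uE'; ring.
by rewrite -uE; ring.
Qed.

End GaussIntegers.

(** * Elements of norm 5^k and 13 * 5^k *)

Section Primitive.
Local Open Scope ring_scope.

Definition gpi := GInt 1 2.
Definition grho := GInt 3 2.

Lemma odd_class_gpi : odd_class gpi. Proof. by exists 0, 0. Qed.
Lemma odd_class_grho : odd_class grho. Proof. by exists 1, 0. Qed.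

Lemma gpiM_conj : gpi * gconj gpi = 5. Proof. by []. Qed.

(** The ideal of 1 + 2i consists of the numbers whose imaginary part is twice the real part modulo
    5; on it, multiplication by 1 + 2i doubles the real part modulo 5. *)
Lemma gpiX_mod5 k : exists a b : int,
  gpi ^+ k.+1 = GInt a (2 * a + 5 * b) /\ ~~ (5 %| a)%Z.
Proof.
elim: k => [|k [a [b [E a5]]]]; first by exists 1, 0.
exists (- 3 * a - 10 * b), (2 * a + 5 * b); rewrite exprS E; split.
  by apply: gint_ext; rewrite ?greM ?gimM /=; ring.
by lia.
Qed.

(** Modulo 5, a^2 + b^2 = (a + 2b)(a - 2b), and the vanishing of either factor is divisibility by
    one of the two primes above 5. *)
Lemma gpi_divides z n : normg z = 5 * n ->
  exists w, normg w = n /\ (z = gpi * w \/ z = gconj gpi * w).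
Proof.
case: z => a b; rewrite /normg /= => E.
have : (5 %| a + 2 * b)%Z || (5 %| a - 2 * b)%Z.
  have : (5 %| (a + 2 * b) * (a - 2 * b))%Z.
    apply/dvdzP; exists (n - b ^+ 2).
    transitivity (a ^+ 2 + b ^+ 2 - 5 * b ^+ 2); first by ring.
    by rewrite E; ring.
  by rewrite !dvdzE abszM Euclid_dvdM.
have conclude w : GInt a b = gpi * w \/ GInt a b = gconj gpi * w -> normg w = n.
  move=> zE; have : normg (GInt a b) = 5 * normg w by case: zE => ->; rewrite normgM.
  by rewrite [LHS]E => /mulfI ->.
case/orP=> /dvdzP[k kE].
  have zE : GInt a b = gpi * GInt k (b - 2 * k).
    have -> : a = 5 * k - 2 * b by rewrite mulrC -kE; ring.
    by apply: gint_ext; rewrite ?greM ?gimM /=; ring.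
  by exists (GInt k (b - 2 * k)); split; [apply: conclude|]; left.
have zE : GInt a b = gconj gpi * GInt k (b + 2 * k).
  have -> : a = 5 * k + 2 * b by rewrite mulrC -kE; ring.
  by apply: gint_ext; rewrite ?greM ?gimM /=; ring.
by exists (GInt k (b + 2 * k)); split; [apply: conclude|]; right.
Qed.

(** Peel off primes above 5 one at a time. If both primes occurred, their product 5 would divide z;
    hence all k factors are the same prime. *)
Lemma primitive_factor k z n : normg z = 5 ^+ k * n -> (forall w, z <> 5 * w) ->
  exists w, normg w = n /\ (z = gpi ^+ k * w \/ z = gconj gpi ^+ k * w).
Proof.
elim: k z => [|k IH] z.
  by rewrite mul1r => E _; exists z; split=> //; left; rewrite mul1r.
rewrite exprS -mulrA => /gpi_divides[w [wE zE]] z5.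
have w5 u : w <> 5 * u.
  by move=> wE5; case: zE => zE; apply: (z5 (_ * u)); rewrite zE wE5 mulrCA.
have [v [vE wE1]] := IH w wE w5.
exists v; split=> //.
have pi5 : gconj gpi * gpi = 5 by [].
case: k IH wE wE1 => [|k] _ _; first by case=> wE1; case: zE => ->; rewrite wE1 mul1r; auto.
case: zE => zE [] wE1.
- by left; rewrite zE wE1 [gpi ^+ k.+2]exprS -mulrA.
- by case: (z5 (gconj gpi ^+ k * v)); rewrite zE wE1 exprS -mulrA mulrA gpiM_conj.
- by case: (z5 (gpi ^+ k * v)); rewrite zE wE1 exprS -mulrA mulrA pi5.
- by right; rewrite zE wE1 [_ ^+ k.+2]exprS -mulrA.
Qed.

Lemma normalized_div p w :
  normalized p -> normalized (p * w) -> normalized w.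
Proof.
move=> /normalizedP[a [b ->]] /normalizedP[c [d E]].
case: w E => x y /(congr1 gint_pair)[]; rewrite /= => ex ey.
apply/normalizedP; exists (c - a * x + b * y), (d - a * y - b * x).
congr GInt.
  transitivity ((2 * a + 1) * x - 2 * b * y - 2 * a * x + 2 * b * y); first by ring.
  by rewrite ex; ring.
transitivity ((2 * a + 1) * y + 2 * b * x - 2 * a * y - 2 * b * x); first by ring.
by rewrite ey; ring.
Qed.

Lemma normalized_norm1 w : normalized w -> normg w = 1 -> w = 1 \/ w = - 1.
Proof.
move=> [a [b [oa ->]]]; rewrite /normg /= => E.
have b0 : b = 0 by nia.
by have [->|->] : a = 1 \/ a = -1 by [nia]; rewrite b0; [left|right].
Qed.

Lemma normalized_norm13 w : normalized w -> normg w = 13 ->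
  w = grho \/ w = - grho \/ w = gconj grho \/ w = - gconj grho.
Proof.
move=> [a [b [oa ->]]]; rewrite /normg /= => E.
have hb : -1 <= b <= 1 by nia.
have ha : -3 <= a <= 3 by nia.
have [b0|[b0|b0]] : b = -1 \/ b = 0 \/ b = 1 by lia.
- by have [->|->] : a = 3 \/ a = -3 by [nia]; rewrite b0; auto.
- by move: E; rewrite b0; nia.
- by have [->|->] : a = 3 \/ a = -3 by [nia]; rewrite b0; auto.
Qed.
End Primitive.

(** * Sums over the representations primitive at 5 *)

Section Sums.
Local Open Scope ring_scope.

(** For 5 | n, a factor 5 in x forces one in y, so exactly the imprimitive representations are
    dropped. *)
Definition prim_reps n := [seq t <- reps n | ~~ (5 %| t.1)%N].

(** The discarded pairs are 5 times the representations of n/25 if 25 | n, and there are none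
    otherwise. Since 25 = 1 modulo 3, the hypothesis also makes the sum for n/25 vanish. *)
Lemma sum_prim_reps (V : zmodType) (f : nat * nat -> V) n :
  (forall t, odd t.1 -> f (5 * t.1, 5 * t.2)%N = f t) ->
  (forall n, (n %% 3 = 2)%N -> \sum_(t <- reps n) f t = 0) ->
  (n %% 3 = 2)%N -> (5 %| n)%N -> \sum_(t <- prim_reps n) f t = 0.
Proof.
move=> f5 H n3 n5.
have y5 x y : (5 %| x)%N -> (5 %| x ^ 2 + 4 * y ^ 2)%N -> (5 %| y)%N.
  by move=> x5; rewrite dvdn_addr ?Euclid_dvdX ?x5 // Gauss_dvdr // Euclid_dvdX // => /andP[].
have := H n n3; rewrite (bigID (fun t : nat * nat => 5 %| t.1)%N) /= big_filter.
suff -> : \sum_(t <- reps n | (5 %| t.1)%N) f t = 0 by rewrite add0r.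
case: (boolP (25 %| n)%N) => [/dvdnP[n' nE]|n25].
  rewrite -big_filter (perm_big [seq (5 * t.1, 5 * t.2)%N | t <- reps n']) /=.
    rewrite big_map -[RHS](H n'); last by lia.
    by apply: eq_big_seq => t; rewrite mem_reps => /and3P[ot _ _]; rewrite f5.
  apply: uniq_perm; first exact/filter_uniq/reps_uniq.
    by rewrite map_inj_uniq ?reps_uniq // => -[a b] [c d] /= [? ?]; congr pair; lia.
  move=> [x y]; rewrite mem_filter mem_reps /=; apply/idP/mapP.
    move=> /and4P[/dvdnP[x' xE] ox y0 /eqP E].
    have /dvdnP[y' yE] : (5 %| y)%N.
      by apply: (y5 x); rewrite ?E // xE dvdn_mull.
    exists (x', y'); last by rewrite xE yE /= !(mulnC 5).
    rewrite mem_reps /=; apply/and3P; split; first by move: ox; rewrite xE oddM => /andP[].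
      by lia.
    by move: E; rewrite xE yE nE !expnMn => E; apply/eqP; lia.
  move=> [[x' y']]; rewrite mem_reps /= => /and3P[ox y0 /eqP E] [-> ->].
  rewrite dvdn_mulr //= oddM ox muln_gt0 y0 /=; apply/eqP.
  by rewrite nE -E !expnMn; lia.
apply: big1_seq => -[x y] /andP[/= x5]; rewrite mem_reps /= => /and3P[_ _ /eqP E].
case/negP: n25; rewrite -E.
have /dvdnP[y' ->] : (5 %| y)%N by apply: (y5 x); rewrite ?E.
move: x5 => /dvdnP[x' ->]; rewrite !expnMn.
by apply/dvdnP; exists (x' ^ 2 + 4 * y' ^ 2)%N; lia.
Qed.

Definition gint_of (t : nat * nat) := GInt t.1%:Z (2 * t.2%:Z).
Definition abs_pair (z : gint) := (`|gre z|, `|gim z| %/ 2)%N.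
(** The symmetries under which an even class function is invariant. Each orbit contains at most one
    [gint_of t], namely for t = [abs_pair z]. *)
Definition assocg (z w : gint) :=
  w = z \/ w = - z \/ w = gconj z \/ w = - gconj z.

Lemma assocg_abs_pair z t : assocg z (gint_of t) -> t = abs_pair z.
Proof.
case: t => x y; case: z => a b.
case=> [|[|[|]]] [] ha hb; rewrite /abs_pair /=; congr pair; lia.
Qed.

Lemma gint_of_abs_pair z : normalized z -> assocg z (gint_of (abs_pair z)).
Proof.
move=> [a [b [_ ->]]]; rewrite /assocg /gint_of /abs_pair /gconj /=.
have -> : (`|(2 * b)%R| %/ 2)%N = `|b|%N by lia.
case: (leP 0 a) => a0; case: (leP 0 b) => b0; rewrite ?(gez0_abs a0) ?(ltz0_abs a0) ?(gez0_abs b0) ?(ltz0_abs b0).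
- by left.
- by right; right; left; rewrite mulrN.
- by right; right; right; apply: gint_ext => /=; rewrite ?opprK.
- by right; left; apply: gint_ext => /=; rewrite ?mulrN.
Qed.

Lemma abs_pair_prim z n : normalized z -> gim z != 0 -> ~~ (5 %| gre z)%Z ->
  normg z = n%:Z -> abs_pair z \in prim_reps n.
Proof.
move=> [a [b [oa ->]]]; rewrite /normg /= => b0 a5 E.
rewrite mem_filter mem_reps /= oa.
have -> : (`|(2 * b)%R| %/ 2)%N = `|b|%N by lia.
move: a5; rewrite dvdzE => -> /=; apply/andP; split; first by lia.
by apply/eqP; move: E; rewrite !exprMn !sqr_absz_nat; lia.
Qed.

Lemma prim_repsP t k n : (0 < k)%N -> t \in prim_reps (5 ^ k * n)%N ->
  exists w, [/\ normalized w, normg w = n%:Z &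
    gint_of t = gpi ^+ k * w \/ gint_of t = gconj gpi ^+ k * w].
Proof.
case: t => x y k0; rewrite mem_filter mem_reps /= => /and4P[x5 ox y0 /eqP E].
have nz : normalized (gint_of (x, y)) by exists x%:Z, y%:Z.
have N : normg (gint_of (x, y)) = 5 ^+ k * n%:Z.
  have -> : (5 ^+ k * n%:Z : int) = (5 ^ k * n)%N by rewrite PoszM; congr (_ * _); rewrite -natrX natz.
  by rewrite -E /normg /=; lia.
have [|w [wn wE]] := primitive_factor N.
  move=> w /(congr1 gre); rewrite greM gint_natr /= mul0r subr0 => xE.
  by case/negP: x5; lia.
exists w; split=> //; have npi := odd_class_normalized odd_class_gpi.
case: wE => wE; move: nz; rewrite wE; apply: normalized_div.
  exact: normalizedX.
exact/normalizedX/normalized_conj.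
Qed.

End Sums.

(** * Evaluation at norms 5^k and 13 * 5^k, and vanishing of class functions *)

Section Independence.
Local Open Scope ring_scope.

(** The cofactor left by [prim_repsP] has norm 1, so it is 1 or -1 and a single orbit remains. *)
Lemma sum_prim_reps_pi (V : zmodType) (f : gint -> V) k : (0 < k)%N ->
  (forall z w, normalized z -> assocg z w -> f w = f z) ->
  \sum_(t <- prim_reps (5 ^ k)%N) f (gint_of t) = f (gpi ^+ k).
Proof.
case: k => // k _ fa.
have npi : normalized (gpi ^+ k.+1) by apply/normalizedX/odd_class_normalized/odd_class_gpi.
have [a [b [E a5]]] := gpiX_mod5 k.
rewrite (perm_big [:: abs_pair (gpi ^+ k.+1)]) /=.
  by rewrite big_seq1 (fa (gpi ^+ k.+1)) //; apply: gint_of_abs_pair.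
apply: uniq_perm => //; first exact/filter_uniq/reps_uniq.
move=> t; rewrite inE; apply/idP/eqP => [|->]; last first.
  apply: abs_pair_prim => //; rewrite ?E //=; first by lia.
  rewrite -E; elim: (k.+1) => // j IH; rewrite exprS normgM IH expnS PoszM //.
rewrite -{1}[(5 ^ k.+1)%N]muln1 => /prim_repsP[] // w [nw wn].
case: (normalized_norm1 nw wn) => ->; rewrite -gconjX ?mulrN !mulr1 => tE;
  apply: assocg_abs_pair; rewrite /assocg; case: tE => ->; auto.
Qed.

(** The cofactor is rho or conj(rho) up to sign. Multiplied by pi^k or its conjugate it gives eight
    numbers, which form two orbits under sign and conjugation. *)
Lemma sum_prim_reps_rho (V : zmodType) (f : gint -> V) k : (0 < k)%N ->
  (forall z w, normalized z -> assocg z w -> f w = f z) ->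
  \sum_(t <- prim_reps (5 ^ k * 13)%N) f (gint_of t) =
  f (grho * gpi ^+ k) + f (grho * gconj (gpi ^+ k)).
Proof.
case: k => // k _ fa.
have npi : normalized (gpi ^+ k.+1) by apply/normalizedX/odd_class_normalized/odd_class_gpi.
have nrho := odd_class_normalized odd_class_grho.
have [a [b [E a5]]] := gpiX_mod5 k.
have N5 : normg (gpi ^+ k.+1) = (5 ^ k.+1)%N.
  by elim: (k.+1) => // j IH; rewrite exprS normgM IH expnS PoszM.
set z1 := grho * gpi ^+ k.+1; set z2 := grho * gconj (gpi ^+ k.+1).
have n1 : normalized z1 by apply: normalizedM.
have n2 : normalized z2 by apply/normalizedM/normalized_conj.
rewrite (perm_big [:: abs_pair z1; abs_pair z2]) /=.
  by rewrite big_cons big_seq1 (fa _ _ n1 (gint_of_abs_pair n1))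
    (fa _ _ n2 (gint_of_abs_pair n2)).
(* In these coordinates, 5 not dividing a yields everything: real parts prime to 5, nonzero
   imaginary parts, and real parts of different absolute value. *)
have [g1 h1] : gre z1 = - a - 10 * b /\ gim z1 = 8 * a + 15 * b.
  by rewrite /z1 E greM gimM /=; split; ring.
have [g2 h2] : gre z2 = 7 * a + 10 * b /\ gim z2 = - 4 * a - 15 * b.
  by rewrite /z2 E greM gimM /=; split; ring.
apply: uniq_perm; first exact/filter_uniq/reps_uniq.
  rewrite /= andbT inE; apply/eqP => /(congr1 fst) e.
  have : `|gre z1|%N = `|gre z2|%N := e.
  by rewrite g1 g2; lia.
move=> t; rewrite !inE; apply/idP/orP => [|[]/eqP ->]; last first.
- apply: abs_pair_prim; rewrite ?g2 ?h2 //; [lia|lia|].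
  rewrite /z2 normgM PoszM -N5 mulrC; congr (_ * _).
  by rewrite /normg /= sqrrN.
- apply: abs_pair_prim; rewrite ?g1 ?h1 //; [lia|lia|].
  by rewrite /z1 normgM PoszM -N5 mulrC.
move=> /prim_repsP[] // w [nw wn]; rewrite -gconjX ![_ * w]mulrC.
have c1 : gconj z1 = gconj grho * gconj (gpi ^+ k.+1) by rewrite gconjM.
have c2 : gconj z2 = gconj grho * gpi ^+ k.+1 by rewrite gconjM gconjK.
case: (normalized_norm13 nw wn) => [->|[->|[->|->]]]; rewrite ?mulNr -?c1 -?c2 => -[] tE.
- by left; apply/eqP/assocg_abs_pair; rewrite tE; left.
- by right; apply/eqP/assocg_abs_pair; rewrite tE; left.
- by left; apply/eqP/assocg_abs_pair; rewrite tE; right; left.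
- by right; apply/eqP/assocg_abs_pair; rewrite tE; right; left.
- by right; apply/eqP/assocg_abs_pair; rewrite tE; right; right; left.
- by left; apply/eqP/assocg_abs_pair; rewrite tE; right; right; left.
- by right; apply/eqP/assocg_abs_pair; rewrite tE; right; right; right.
- by left; apply/eqP/assocg_abs_pair; rewrite tE; right; right; right.
Qed.

(** Divisibility of the cross term by 4 already detects the parity of the class, and the class of
    t^k has the parity of k. *)
Lemma odd_class_cross_parity t k z s (a b : int) : odd_class t ->
  z = GInt (2 * a + 1) (2 * b) -> (2 ^+ s.+2 %| crossg (t ^+ k) z)%Z ->
  odd k = odd `|b|%N.
Proof.
move=> ot ->; have [c [d ->]] := odd_class_expr k ot.
rewrite !exprS mulrA => /dvdzP[u]; rewrite /crossg /= => E.
move: E; set e := (odd k : nat)%:Z => E.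
have : 2 * (e - b) = 2 * (2 * (u * 2 ^+ s - d * (2 * a + 1) - e * a + b * c)).
  have -> : 2 * (e - b) = (2 * (2 * d + e) * (2 * a + 1) - 2 * b * (2 * c + 1)) -
      4 * (d * (2 * a + 1) + e * a - b * c) by ring.
  by rewrite E; ring.
by move: (u * _ - _ - _ + _) => v; rewrite /e; case: (odd k); lia.
Qed.

(** Here f is an even function of the class modulo 2q with q = 2^s. For odd k both 5^k and 13 * 5^k
    are 2 modulo 3, so the hypothesis on sums applies to them. *)
Lemma class_function_eq0 (s : nat) (f : gint -> 'F_2) :
  (forall z w, normalized z -> normalized w ->
     (2 ^+ s.+2 %| crossg z w)%Z -> f z = f w) ->
  (forall z, f (gconj z) = f z) -> f 1 = 0 ->
  (forall n, (n %% 3 = 2)%N -> \sum_(t <- reps n) f (gint_of t) = 0) ->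
  forall z, normalized z -> f z = 0.
Proof.
move=> fE fJ f1 fS.
have cross0 z w : crossg z w = 0 -> (2 ^+ s.+2 %| crossg z w)%Z by move=> ->; rewrite dvdz0.
have fN z : normalized z -> f (- z) = f z.
  move=> nz; apply: fE => //; first exact: normalizedN.
  by apply: cross0; rewrite /crossg /=; ring.
have fa z w : normalized z -> assocg z w -> f w = f z.
  move=> nz; case=> [|[|[|]]] ->; rewrite ?fJ ?fN ?fJ //.
  exact: normalized_conj.
have npi := odd_class_normalized odd_class_gpi.
have nrho := odd_class_normalized odd_class_grho.
have f5 t : odd t.1 -> f (gint_of (5 * t.1, 5 * t.2)%N) = f (gint_of t).
  move=> ot; apply: fE; try by [exists t.1%:Z, t.2%:Z]; last first.
    by apply: cross0; rewrite /crossg /= !PoszM; ring.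
  by exists (5 * t.1)%N%:Z, (5 * t.2)%N%:Z; rewrite /= oddM.
have mod3 k : odd k -> (5 ^ k %% 3 = 2)%N.
  move=> ok; rewrite -(odd_double_half k) ok add1n expnS -mul2n expnM.
  by rewrite -modnMm -[((5 ^ 2) ^ _ %% 3)%N]modnXm exp1n.
have fpi k : odd k -> f (gpi ^+ k) = 0.
  move=> ok; rewrite -sum_prim_reps_pi ?odd_gt0 //.
  apply: (@sum_prim_reps _ (f \o gint_of)) => //; first exact: mod3.
  by rewrite Euclid_dvdX // odd_gt0.
have frho k : odd k -> f (grho * gpi ^+ k) = f (grho * gconj (gpi ^+ k)).
  move=> ok; apply/eqP; rewrite -subr_eq0 oppr_pchar2 //; apply/eqP.
  rewrite -sum_prim_reps_rho ?odd_gt0 //.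
  apply: (@sum_prim_reps _ (f \o gint_of)) => //; first by rewrite -modnMm mod3.
  by rewrite dvdn_mulr // Euclid_dvdX // odd_gt0.
have frhoX l : f (grho ^+ l.*2) = 0.
  elim: l => [|l IH]; first by rewrite expr0.
  have [c [d zE]] := odd_class_expr l.*2.+1 odd_class_grho.
  have nz := normalizedX l.*2.+1 nrho.
  (* Replace rho^(2l+1) by a power pi^k in the same class; its class is odd, so k is odd and [frho]
     applies. *)
  have [k kE] := odd_class_generates s.+1 odd_class_gpi nz.
  have ok : odd k.
    rewrite (odd_class_cross_parity odd_class_gpi zE kE) /= odd_double /=.
    by lia.
  have nk := normalizedX k npi.
  have crossM p q u : (2 ^+ s.+2 %| crossg p q)%Z -> (2 ^+ s.+2 %| crossg (u * p) (u * q))%Z.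
    by move=> h; rewrite crossgM dvdz_mull.
  (* The chain of classes is rho^(2l+2), rho pi^k, rho conj(pi^k), rho conj(rho)^(2l+1) = 13
     conj(rho)^(2l). The integer 13 does not change the class, and conjugation then gives
     rho^(2l). *)
  rewrite doubleS exprS -(fE (grho * gpi ^+ k)); [|exact: normalizedM|exact: normalizedM|exact: crossM].
  rewrite frho // (fE _ (grho * gconj (grho ^+ l.*2.+1))); last first.
  - apply: crossM; have -> : forall p q, crossg (gconj p) (gconj q) = - crossg p q.
      by move=> p q; rewrite /crossg /=; ring.
    by rewrite rpredN.
  - exact/normalizedM/normalized_conj.
  - exact/normalizedM/normalized_conj.
  rewrite exprS gconjM mulrA -IH -fJ; apply: fE.
  - apply/normalized_conj/normalizedM; last exact/normalized_conj/normalizedX.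
    exact/normalizedM/normalized_conj.
  - exact: normalizedX.
  apply: cross0; move: (grho ^+ _) => p.
  by case: p => x y; rewrite /crossg /=; ring.
move=> z nz; have [a [b zE]] := (normalizedP z).1 nz.
case ob: (odd `|b|%N).
  have [k kE] := odd_class_generates s.+1 odd_class_gpi nz.
  rewrite -(fE _ _ _ _ kE) //; last exact: normalizedX.
  by apply: fpi; rewrite (odd_class_cross_parity odd_class_gpi zE kE).
have [k kE] := odd_class_generates s.+1 odd_class_grho nz.
rewrite -(fE _ _ _ _ kE) //; last exact: normalizedX.
have := odd_class_cross_parity odd_class_grho zE kE; rewrite ob => ok.
by rewrite -(odd_double_half k) ok add0n.
Qed.

End Independence.

(** * Linear spans and their images under [p32] *)

Section Spans.
Local Open Scope classical_set_scope.
Local Open Scope ring_scope.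

Lemma submod_closedP (K : fieldType) (V : lmodType K) (S : set V) :
  GRing.submod_closed (mem S) <->
  S 0 /\ forall a u v, S u -> S v -> S (a *: u + v).
Proof.
split=> [[/set_mem S0 SD]|[S0 SD]]; split=> //.
- by move=> a u v Su Sv; apply: set_mem; apply: SD; apply: mem_set.
- exact: mem_set.
- by move=> a u v /set_mem Su /set_mem Sv; apply/mem_set/SD.
Qed.

Lemma lspan_submod (K : fieldType) (V : lmodType K) (G : set V) :
  GRing.submod_closed (mem (lspan G)).
Proof.
apply/submod_closedP; split=> [|a u v].
  by exists 0%N, (fun=> 0), (fun=> 0); split=> [[]|] //; rewrite big_ord0.
move=> [n [g [c [Gg ->]]]] [n' [g' [c' [Gg' ->]]]].
exists (n + n')%N.
exists (fun i => match fintype.split i with inl j => g j | inr j => g' j end).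
exists (fun i => match fintype.split i with inl j => a * c j | inr j => c' j end).
split=> [i|]; first by case: (fintype.split i).
rewrite big_split_ord /= scaler_sumr; congr (_ + _); apply: eq_bigr => i _.
  by rewrite (unsplitK (inl i)) scalerA.
by rewrite (unsplitK (inr i)).
Qed.

Lemma lspan_gen (K : fieldType) (V : lmodType K) (G : set V) v : G v -> lspan G v.
Proof.
move=> Gv; exists 1%N, (fun=> v), (fun=> 1); split=> //.
by rewrite big_ord1 scale1r.
Qed.

Lemma submod_sum (K : fieldType) (V : lmodType K) (S : set V) n
    (g : 'I_n -> V) (c : 'I_n -> K) : GRing.submod_closed (mem S) ->
  (forall i, S (g i)) -> S (\sum_(i < n) c i *: g i).
Proof.
move=> /submod_closedP[S0 SD] Sg; apply: (big_ind S) => //.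
  by move=> x y Sx Sy; rewrite -[x]scale1r; apply: SD.
by move=> i _; rewrite -[_ *: _]addr0; apply: SD.
Qed.

Lemma lspan_min (K : fieldType) (V : lmodType K) (G S : set V) :
  GRing.submod_closed (mem S) -> G `<=` S -> lspan G `<=` S.
Proof. by move=> Ss GS _ [n [g [c [Gg ->]]]]; apply: submod_sum => // i; apply: GS. Qed.

Lemma p32_linear (a : 'F_2) (f g : series2) : p32 (a *: f + g) = a *: p32 f + p32 g.
Proof.
apply/funext => n; rewrite /p32 !fctE; case: ifP => // _.
by rewrite scaler0 addr0.
Qed.

Lemma p320 : p32 0 = 0.
Proof. by apply/funext => n; rewrite /p32; case: ifP. Qed.

Lemma p32_image_submod (G : set series2) :
  GRing.submod_closed (mem (p32 @` lspan G)).
Proof.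
have /submod_closedP[S0 SD] := lspan_submod G; apply/submod_closedP; split.
  by exists 0; [|exact: p320].
move=> a _ _ [f Gf <-] [g Gg <-]; exists (a *: f + g); last exact: p32_linear.
exact: SD.
Qed.

(** Generators in G may map anywhere into the span of B, which accommodates the classes 0 and q,
    whose theta series map to 0. *)
Lemma p32_image_span (G B : set series2) :
  (forall g, G g -> lspan B (p32 g)) -> (forall b, B b -> exists2 g, G g & p32 g = b) ->
  lspan B = p32 @` lspan G.
Proof.
move=> GB BG; apply/seteqP; split.
  apply: lspan_min; first exact: p32_image_submod.
  by move=> b /BG[g Gg <-]; exists g => //; apply: lspan_gen.
have pre_closed : GRing.submod_closed (mem [set f | lspan B (p32 f)]).
  have /submod_closedP[S0 SD] := lspan_submod B; apply/submod_closedP; split.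
    by rewrite /= p320.
  by move=> a u v; rewrite /= p32_linear; apply: SD.
by move=> _ [f /(lspan_min pre_closed GB) ? <-].
Qed.

End Spans.

(** * The series attached to a class *)

Section Classes.
Local Open Scope classical_set_scope.
Local Open Scope ring_scope.

(** The modulus is 4q for q = 2^m. The relation is boolean so that it can be counted in sums over
    [reps]. *)
Definition equivg (m : nat) (z w : gint) : bool := (2 ^+ m.+2 %| crossg z w)%Z.

Lemma equivgC m z w : equivg m z w = equivg m w z.
Proof.
rewrite /equivg -[crossg w z]opprK rpredN; congr (_ %| _)%Z.
by rewrite /crossg; ring.
Qed.

Lemma equivg_gconj m z w : equivg m (gconj z) w = equivg m z (gconj w).
Proof.
rewrite /equivg -[crossg z _]opprK rpredN; congr (_ %| _)%Z.
by rewrite /crossg /=; ring.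
Qed.

Lemma coprimez_two_power m (a : int) : odd `|a|%N -> coprimez (2 ^+ m) a.
Proof. by move=> oa; rewrite coprimezE abszX coprimeXl // coprime2n. Qed.

(** The real part of the middle term is odd, hence can be cancelled modulo a power of 2. *)
Lemma equivg_trans m w z u : normalized w ->
  equivg m z w -> equivg m w u -> equivg m z u.
Proof.
move=> [a [b [oa wE]]] zw wu.
rewrite /equivg -(@Gauss_dvdzl _ _ a) ?coprimez_two_power //.
have -> : crossg z u * a = crossg z w * gre u + crossg w u * gre z.
  by rewrite /crossg wE /=; ring.
by rewrite rpredD // dvdz_mulr.
Qed.

Lemma equivg_transr m w w' z : normalized w -> normalized w' ->
  equivg m w w' -> equivg m z w = equivg m z w'.
Proof.
move=> nw nw' ww'; apply/idP/idP => zw; first exact: equivg_trans zw ww'.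
by apply: equivg_trans zw _; rewrite // equivgC.
Qed.

(** Eliminating N between the two coordinates of the congruence leaves the cross term. Conversely N
    = x/a works, a being invertible modulo 4q. *)
Lemma gauss_equivP m (a b : int) J : odd `|a|%N ->
  gauss_equiv (2 ^ m) (principal (GInt a (2 * b))) J <->
  exists x y : int, [/\ odd `|x|%N,
    equivg m (GInt x (2 * y)) (GInt a (2 * b)) & J = principal (GInt x (2 * y))].
Proof.
have qE : (4 * 2 ^ m)%N%:Z = 2 ^+ m.+2 :> int.
  by rewrite -[4%N]/(2 ^ 2)%N -expnD add2n -natrX natz.
move=> oa; split.
  move=> [alpha [beta [[a' [b' [oa' ->]]] [x [y [ox ->]]] EI EJ [N [[g h] E]]]]].
  exists x, y; split=> //.
  move: E; rewrite gint_intr gint_natr => /(congr1 gint_pair)[].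
  rewrite /= qE => e1 e2.
  have : equivg m (GInt x (2 * y)) (GInt a' (2 * b')).
    apply/dvdzP; exists (2 * b' * g - a' * h); rewrite /crossg /=.
    move: (2 ^+ m.+2) e1 e2 => e e1 e2.
    transitivity (2 * b' * (e * g - 0 * h) - a' * (e * h + 0 * g)); last by ring.
    by rewrite -e1 -e2; ring.
  case: (principal_inj oa oa' EI) => -[-> ->] //.
  by rewrite /equivg -rpredN; congr (_ %| _)%Z; rewrite /crossg /=; ring.
move=> [x [y [ox /dvdzP[k kE] ->]]].
exists (GInt a (2 * b)), (GInt x (2 * y)); split=> //; try by [exists a, b|exists x, y].
have /eqP := coprimez_two_power m.+2 oa => g1.
have [u [v]] := Bezoutz (2 ^+ m.+2) a; rewrite g1 => uv.
exists (v * x), (GInt (- u * x) (- v * k - u * (2 * y))).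
rewrite gint_intr gint_natr qE; move: (2 ^+ m.+2) uv kE => e uv; rewrite /crossg /= => kE.
apply: gint_ext; rewrite /= ?mul0r ?subr0 ?addr0.
  transitivity (x * (u * e + v * a) - x - e * u * x); first by ring.
  by rewrite uv; ring.
transitivity (- v * (2 * y * a - 2 * b * x) + (u * e + v * a) * (2 * y) - 2 * y - e * u * (2 * y)).
  by ring.
by rewrite uv kE; ring.
Qed.

Lemma odd_ideal_normalized (x y : int) : odd `|x|%N ->
  odd_ideal (principal (GInt x (2 * y))).
Proof.
move=> ox; split; first exact: principal_ideal.
rewrite ideal_norm_normalized // !sqr_absz_nat.
by rewrite -[4]/(4%N%:Z) -PoszM -PoszD absz_nat oddD oddM oddX ox.
Qed.

Lemma theta_gauss_class m (a b : int) n : odd `|a|%N -> (n %% 3 = 2)%N ->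
  theta [set J | odd_ideal J /\
    gauss_equiv (2 ^ m) (principal (GInt a (2 * b))) J] n =
  (\sum_(t <- reps n) (equivg m (gint_of t) (GInt a (2 * b)) +
     equivg m (gconj (gint_of t)) (GInt a (2 * b))))%N.
Proof.
move=> oa n3.
rewrite (theta_reps (Q := fun x y => equivg m (GInt x (2 * y)) (GInt a (2 * b)))) //.
- by congr Posz; apply: eq_bigr => t _; rewrite mulrN.
- move=> x y; rewrite /equivg -rpredN; congr (_ %| _)%Z.
  by rewrite /crossg /=; ring.
- by move=> J [_ /(gauss_equivP _ _ _ oa)] + _.
- move=> x y ox Qxy; split; first exact: odd_ideal_normalized.
  by apply/(gauss_equivP _ _ _ oa); exists x, y.
Qed.

(* The representative of the class c modulo 2q. *)
Definition repg (c : nat) : gint := GInt 1 (2 * c%:Z).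

Lemma normalized_repg c : normalized (repg c).
Proof. by exists 1, c%:Z. Qed.

(** [AMB] is the class c = q, since bq/a = q modulo 2q for odd a and b. *)
Lemma theta_AMB m n : (n %% 3 = 2)%N ->
  theta (AMB (2 ^ m)) n =
  (\sum_(t <- reps n) (equivg m (gint_of t) (repg (2 ^ m)) +
     equivg m (gconj (gint_of t)) (repg (2 ^ m))))%N.
Proof.
have qE : (2 ^ m)%N%:Z = 2 ^+ m :> int by rewrite -natrX natz.
move=> n3; rewrite (theta_reps (Q := fun x y => equivg m (GInt x (2 * y)) (repg (2 ^ m)))) //.
- by congr Posz; apply: eq_bigr => t _; rewrite mulrN.
- move=> x y; rewrite /equivg -rpredN; congr (_ %| _)%Z.
  by rewrite /crossg /=; ring.
- move=> J [a [b [oa ob ->]]] _; exists a, (b * 2 ^+ m); split=> //; last by rewrite qE mulrA.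
  have [k ak] := (oddzP a).1 oa; have [l bl] := (oddzP b).1 ob.
  apply/dvdzP; exists (l - k); rewrite /crossg /= qE !exprS ak bl; ring.
- move=> x y ox /dvdzP[k]; rewrite /crossg /= qE !exprS => kE.
  exists x, (2 * k + x); split=> //; first by have [l ->] := (oddzP x).1 ox; lia.
  congr (principal (GInt _ _)); rewrite qE.
  transitivity (2 * y * 1 - 2 * 2 ^+ m * x + 2 * 2 ^+ m * x); first by ring.
  by rewrite kE; ring.
Qed.

(** Conjugation negates the class, and c = -c modulo 2q exactly when q | c. *)
Lemma equivg_repg_gconj m c : equivg m (repg c) (gconj (repg c)) = (2 ^ m %| c)%N.
Proof.
have -> : (2 ^ m %| c)%N = (2 ^+ m.+2 %| 4 * c%:Z)%Z.
  by rewrite dvdzE abszM !abszX !expnS mulnA dvdn_pmul2l.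
by rewrite /equivg; congr (_ %| _)%Z; rewrite /crossg /=; ring.
Qed.

Lemma equivg_repg m z : normalized z ->
  exists2 c, (c < 2 ^ m.+1)%N & equivg m z (repg c).
Proof.
move=> [a [b [oa ->]]].
have /eqP := coprimez_two_power m.+2 oa => g1.
have [u [v]] := Bezoutz (2 ^+ m.+2) a; rewrite g1 => uv.
pose M := (2 ^ m.+1)%N.
have ME : M%:Z = 2 ^+ m.+1 by rewrite /M -natrX natz.
have M0 : M%:Z != 0 by rewrite ME expf_neq0.
pose c := (v * b %% M)%Z; have c0 : 0 <= c := modz_ge0 _ M0.
have cE : v * b = (v * b %/ M)%Z * M + c := divz_eq _ _.
have cM : c < M by rewrite -[X in _ < Posz X]absz_nat; exact: ltz_mod.
exists `|c|%N; first by rewrite -/M; clear -c0 cM; lia.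
rewrite /equivg /crossg /= gez0_abs //.
apply/dvdzP; exists (2 * b * u + (v * b %/ M)%Z * a).
move: cE; set k := (v * b %/ M)%Z => cE.
have -> : c = v * b - k * M by rewrite cE; ring.
transitivity (2 * b * (u * 2 ^+ m.+2 + v * a) - 2 * (v * b - k * M) * a); first by rewrite uv; ring.
by rewrite ME [2 ^+ m.+2]exprS; ring.
Qed.

(** The disjunction equals the sum of the two indicators when c and -c are different classes, and
    counts each pair once when c = q, which gives half of [AMB]. *)
Definition class_series (m c : nat) : series2 := fun n =>
  if (n %% 3 == 2)%N then \sum_(t <- reps n)
    (equivg m (gint_of t) (repg c) || equivg m (gconj (gint_of t)) (repg c) : nat)%:R
  else 0.

Lemma natr_F2_double (n : nat) : (n + n)%:R = 0 :> 'F_2.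
Proof. by rewrite natrD addrr_pchar2. Qed.

Lemma p32_mod2_reps (f : nat -> int) (g : nat * nat -> nat) (h : nat * nat -> 'F_2) :
  (forall n, (n %% 3 = 2)%N -> f n = (\sum_(t <- reps n) g t)%N) ->
  (forall n t, t \in reps n -> (g t)%:R = h t) ->
  p32 (mod2 f) = fun n => if (n %% 3 == 2)%N then \sum_(t <- reps n) h t else 0.
Proof.
move=> fg gh; apply/funext => n; rewrite /p32 /mod2; case: eqP => // n3.
rewrite fg // -pmulrn natr_sum; apply: eq_big_seq => t /gh; exact.
Qed.

Lemma gint_of_normalized n t : t \in reps n -> normalized (gint_of t).
Proof. by rewrite mem_reps => /and3P[ot _ _]; exists t.1%:Z, t.2%:Z. Qed.

(** For 0 < c < q the classes c and -c differ, so no pair satisfies both conditions. *)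
Lemma p32_theta_class m (a b : int) c : odd `|a|%N -> (0 < c < 2 ^ m)%N ->
  equivg m (GInt a (2 * b)) (repg c) \/ equivg m (GInt a (2 * b)) (gconj (repg c)) ->
  p32 (mod2 (theta [set J | odd_ideal J /\
    gauss_equiv (2 ^ m) (principal (GInt a (2 * b))) J])) = class_series m c.
Proof.
move=> oa /andP[c0 cq] ac.
apply: p32_mod2_reps; first by move=> n; apply: theta_gauss_class.
move=> n t /gint_of_normalized nt.
have na : normalized (GInt a (2 * b)) by exists a, b.
have nc := normalized_repg c.
suff -> : (equivg m (gint_of t) (GInt a (2 * b)) +
    equivg m (gconj (gint_of t)) (GInt a (2 * b)) =
  equivg m (gint_of t) (repg c) + equivg m (gconj (gint_of t)) (repg c))%N.
  case E1: (equivg m (gint_of t) (repg c)); case E2: (equivg m _ (repg c)) => //.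
  have : equivg m (repg c) (gconj (repg c)).
    apply: (equivg_trans nt); first by rewrite equivgC.
    by rewrite -equivg_gconj.
  by rewrite equivg_repg_gconj gtnNdvd.
case: ac => ac; first by rewrite !(equivg_transr _ na nc ac).
rewrite !(equivg_transr _ na (normalized_conj nc) ac) addnC.
by rewrite equivg_gconj gconjK -[X in (_ + nat_of_bool X)%N]equivg_gconj.
Qed.

(** In a self-conjugate class the two conjugate ideals of each pair cancel modulo 2. *)
Lemma p32_theta_class_amb m (a b : int) c : odd `|a|%N -> (2 ^ m %| c)%N ->
  equivg m (GInt a (2 * b)) (repg c) ->
  p32 (mod2 (theta [set J | odd_ideal J /\
    gauss_equiv (2 ^ m) (principal (GInt a (2 * b))) J])) = 0.
Proof.
move=> oa cq ac.
transitivity (fun n => if (n %% 3 == 2)%N then \sum_(t <- reps n) (0 : 'F_2) else 0).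
  apply: p32_mod2_reps; first by move=> n; apply: theta_gauss_class.
  move=> n t _; have nc := normalized_repg c.
  have na : normalized (GInt a (2 * b)) by exists a, b.
  rewrite !(equivg_transr _ na nc ac) equivg_gconj.
  rewrite -(equivg_transr _ nc (normalized_conj nc)) ?natr_F2_double //.
  by rewrite equivg_repg_gconj.
by apply/funext => n; case: ifP => // _; rewrite big1.
Qed.

Lemma p32_half_AMB m : p32 (mod2 (Defs.half (theta (AMB (2 ^ m))))) = class_series m (2 ^ m).
Proof.
apply: (@p32_mod2_reps _ (fun t => equivg m (gint_of t) (repg (2 ^ m)) : nat)) => [n n3|n t _].
  rewrite /Defs.half theta_AMB //.
  rewrite (eq_bigr (fun t => (equivg m (gint_of t) (repg (2 ^ m)) * 2)%N)).
    by rewrite -big_distrl /= PoszM mulzK.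
  move=> t _; rewrite equivg_gconj muln2 -addnn.
  rewrite -(@equivg_transr m (repg (2 ^ m)) (gconj (repg (2 ^ m)))) //.
  - exact: normalized_repg.
  - exact/normalized_conj/normalized_repg.
  - by rewrite equivg_repg_gconj.
rewrite equivg_gconj -(@equivg_transr m (repg (2 ^ m)) (gconj (repg (2 ^ m)))) ?orbb //.
- exact: normalized_repg.
- exact/normalized_conj/normalized_repg.
- by rewrite equivg_repg_gconj.
Qed.

Lemma DI_span m : lspan (range (fun i : 'I_(2 ^ m) => class_series m i.+1)) = DI (2 ^ m).
Proof.
apply: p32_image_span; last first.
  move=> _ [i _ <-]; case: (ltnP i.+1 (2 ^ m)) => iq; last first.
    have -> : i.+1 = (2 ^ m)%N by apply/eqP; rewrite eqn_leq ltn_ord.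
    by exists (mod2 (Defs.half (theta (AMB (2 ^ m))))); [right|exact: p32_half_AMB].
  exists (mod2 (theta [set J | odd_ideal J /\
      gauss_equiv (2 ^ m) (principal (GInt 1 (2 * i.+1%:Z))) J])); last first.
    by apply: p32_theta_class => //; left; rewrite /equivg /crossg subrr dvdz0.
  left; exists [set J | odd_ideal J /\
      gauss_equiv (2 ^ m) (principal (GInt 1 (2 * i.+1%:Z))) J] => //.
  by exists (principal (GInt 1 (2 * i.+1%:Z))); split=> //; apply: odd_ideal_normalized.
have span0 : lspan (range (fun i : 'I_(2 ^ m) => class_series m i.+1)) 0.
  by have /submod_closedP[] :=
    lspan_submod (range (fun i : 'I_(2 ^ m) => class_series m i.+1)).
have spanc c : (0 < c <= 2 ^ m)%N ->
    lspan (range (fun i : 'I_(2 ^ m) => class_series m i.+1)) (class_series m c).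
  case: c => // c cq; apply: lspan_gen; exists (Ordinal cq) => //.
move=> _ [[R [I [oI ->]] <-]|->]; last first.
  by rewrite p32_half_AMB; apply: spanc; rewrite expn_gt0 leqnn.
(* A normalized generator of I is read off from any equivalence I ~ J; if there is none, the class
   is empty and its theta series is 0. *)
case: (pselect (exists J, gauss_equiv (2 ^ m) I J)) => [|noJ]; last first.
  suff -> : [set J | odd_ideal J /\ gauss_equiv (2 ^ m) I J] = set0.
    have -> : p32 (mod2 (theta set0)) = 0; last exact: span0.
    apply/funext => n; rewrite /p32 /mod2 /theta set0I fset_set0 cardfs0.
    by case: ifP.
  by apply/seteqP; split=> // J [_ IJ]; apply: noJ; exists J.
move=> [J [alpha [beta [nalpha _ -> _ _]]]].
have [c cq ac] := equivg_repg m nalpha.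
have [a [b [oa aE]]] := nalpha; move: ac; rewrite aE => ac.
case: (boolP (2 ^ m %| c)%N) => qc; first by rewrite (p32_theta_class_amb oa qc ac).
have c0 : (0 < c)%N by case: c qc {cq ac}; rewrite ?dvdn0.
case: (ltnP c (2 ^ m)) => cq'.
  by rewrite (@p32_theta_class m a b c) ?c0 //; [apply: spanc; rewrite c0 ltnW|left].
have cq2 : (c != 2 ^ m)%N by apply: contraNneq qc => ->.
(* For q < c < 2q the conjugate class 2q - c lies in the range of the basis. *)
have c'q : (0 < 2 ^ m.+1 - c < 2 ^ m)%N by move: cq cq' cq2; rewrite expnS; lia.
rewrite (@p32_theta_class m a b (2 ^ m.+1 - c)) //.
  by apply: spanc; case/andP: c'q => -> /ltnW.
right; apply: equivg_trans (normalized_repg c) ac _.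
apply/dvdzP; exists 1; rewrite /crossg /= -subzn ?(ltnW cq) //.
have -> : (2 ^ m.+1)%N%:Z = 2 ^+ m.+1 :> int by rewrite -natrX natz.
by rewrite [2 ^+ m.+2]exprS; ring.
Qed.

(** A relation with coefficients e_i becomes the even class function f with value e_i on the classes
    of i + 1 and -(i + 1), and 0 on class 0. It vanishes by [class_function_eq0]. *)
Lemma class_series_independent m :
  lin_independent (fun i : 'I_(2 ^ m) => class_series m i.+1).
Proof.
move=> e e0.
have qE : (4 * 2 ^ m)%N%:Z = 2 ^+ m.+2 :> int.
  by rewrite -[4%N]/(2 ^ 2)%N -expnD add2n -natrX natz.
pose hit c z := equivg m z (repg c) || equivg m (gconj z) (repg c).
pose f z : 'F_2 := \sum_(i < 2 ^ m) e i * (hit i.+1 z : nat)%:R.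
have f0 : forall z, normalized z -> f z = 0.
  apply: (@class_function_eq0 m).
  - move=> z w nz nw zw; apply: eq_bigr => i _; congr (_ * (nat_of_bool _)%:R).
    rewrite /hit !equivg_gconj ![equivg _ _ (repg _)]equivgC ![equivg _ _ (gconj (repg _))]equivgC.
    by congr (_ || _); apply: equivg_transr.
  - by move=> z; apply: eq_bigr => i _; rewrite /hit gconjK orbC.
  - apply: big1 => i _; suff -> : hit i.+1 1 = false by rewrite mulr0.
    rewrite /hit /equivg /crossg /= -qE; have := ltn_ord i; move: (2 ^ m)%N (nat_of_ord i) => q j jq.
    by rewrite !dvdzE /=; apply/negbTE; rewrite negb_or; apply/andP; split;
      rewrite gtnNdvd; lia.
  move=> n n3; rewrite -[RHS]/((0 : series2) n) -e0 fct_sumE exchange_big /=.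
  apply: eq_bigr => i _.
  by rewrite !fctE /class_series n3 /= scaler_sumr.
move=> i; rewrite -(f0 (repg i.+1) (normalized_repg _)) /f (bigD1 i) //= big1 => [|j ji].
  suff -> : hit i.+1 (repg i.+1) by rewrite mulr1 addr0.
  by rewrite /hit /equivg /crossg subrr dvdz0.
suff -> : hit j.+1 (repg i.+1) = false by rewrite mulr0.
(* As i + 1 and j + 1 are distinct and lie between 1 and q, neither their difference nor their sum
   is divisible by 2q. *)
have : (nat_of_ord j != i)%N by [].
rewrite /hit /equivg /crossg /= -qE; move: (ltn_ord i) (ltn_ord j).
move: (2 ^ m)%N (nat_of_ord i) (nat_of_ord j) => q k l kq lq kl.
by rewrite !dvdzE /=; apply/negbTE; rewrite negb_or; apply/andP; split;
  rewrite gtnNdvd; lia.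
Qed.

End Classes.

Theorem theorem3p12 (q : nat) (hq : exists m : nat, q = 2 ^ m) :
  subspace_of_dim (DI q) q.
Proof.
case: hq => m ->; split; first exact: p32_image_submod.
exists (fun i => class_series m i.+1); split; first exact: class_series_independent.
exact: DI_span.
Qed.
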